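(* Let $\mathcal{I}$ be an input complex, and let $GS\in\mathit{ITER}$ be an algorithm that uses the same read-write pattern as iterated collect, with the sequence of encoding functions $\omega_{GS}=GS(\mathcal{I})$ produced by the Greedy Star algorithm. Then $$\Xi_{GS}(\mathcal{I})\cong\Xi_{\mathit{FI}_{IC}}(\mathcal{I}).$$
   Context: Complexes. All simplicial complexes are chromatic: they carry a coloring $\pi$ of vertices by process identifiers in $\Pi$, with distinct colors on the vertices of a simplex. $\cong$ denotes isomorphism of such complexes. The star $\mathrm{St}(\mathcal{K},v)$ is the subcomplex made of all simplices of $\mathcal{K}$ containing $v$ (together with their faces). An input complex $\mathcal{I}$ has as vertices the possible initial states (process together with input) and as simplices the possible joint input configurations of the participating processes. The family $\mathit{ITER}$. An algorithm $A\in\mathit{ITER}$ with $R$ rounds uses memory layers $M[1],\dots,M[R]$, each an array of single-writer multi-reader registers, one per process, initialized to $\bot$. Process $p_i$ starts with a local state $s$ given by its input. In round $k$ it writes $\omega_k(s)$ to $M[k,i]$, then (after its write is complete) reads layer $M[k]$, obtaining a view $v$, and sets $s\gets\sigma_k(s,v)$, where $\omega_k$ are the encoding functions and $\sigma_k$ the next-state functions. Executions are wait-free and asynchronous, and processes may crash. Iterated collect (IC): after writing, a process reads the registers of the layer one by one, in any order. $\Xi_A(\mathcal{I})$ is the chromatic complex whose vertices are the pairs (process, local state after the last round) reachable in executions of $A$ from input configurations in $\mathcal{I}$, and whose simplices are the sets of such pairs occurring jointly in one execution. $\mathit{FI}_{IC}$ is the algorithm with the IC pattern whose encoding function is the identity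 on states and whose next-state function returns the view just read; $\Xi_{\mathit{FI}_{IC}}$ is its one-round protocol map. Greedy Star, $GS(\mathcal{I})$. Initialize $\mathcal{A}\gets\emptyset$, $V\gets V(\mathcal{I})$, $W\gets\emptyset$ (a sequence), $r\gets 0$. While $\mathcal{A}\ne\mathcal{I}$: let $\omega_r:V(\mathcal{I})\to\mathbb{N}\cup\{\bot\}$ be constantly $\bot$; set $\mathcal{U}\gets\emptyset$, $V_u\gets\emptyset$; for each $v\in V$, put $\mathcal{S}=\mathrm{St}(\mathcal{I},v)$, and if $\mathrm{St}(\mathcal{I},w)\cap\mathcal{U}=\emptyset$ for all $w\in V(\mathcal{S})$, then set $\mathcal{U}\gets\mathcal{U}\cup\mathcal{S}$, $V_u\gets V_u\cup V(\mathcal{S})$, and redefine $\omega_r$ on $V(\mathcal{S})$ with values in $\mathbb{N}$ so that no two distinct vertices of $V(\mathcal{S})$ of the same color have the same value. After the for loop, set $\mathcal{A}\gets\mathcal{A}\cup\mathcal{U}$, $V\gets V\setminus V_u$, append $\omega_r$ to $W$, and $r\gets r+1$. Return $W$. The algorithm $GS\in\mathit{ITER}$. All processes use the same sequence $\omega_{GS}=GS(\mathcal{I})$. In each round a process at input vertex $v$ writes the value $\omega_k(v)$ of that round's encoding function; if this value is $\bot$ the process ignores the shared memory in that round and keeps its local state. Otherwise the next-state function maps each value read to the corresponding process's input state by inverting the encoding $\omega_k$, and the process adds these states to its accumulated knowledge; information learned is retained across rounds. The final local state is the set of input states learned. *)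

(* Defs.v *)
From mathcomp Require Import all_boot.
From mathcomp Require Import boolp.

Set Implicit Arguments.
Unset Strict Implicit.
Unset Printing Implicit Defensive.

(* Finite chromatic complexes over a finite set Pi of process identifiers.
   Simplices are nonempty.  The carrier [vtx] may contain elements that are not
   vertices: the vertex set is [cover (simplices K)]. *)
Record chromatic_complex (Pi : finType) := ChromaticComplex {
  vtx : finType;
  color : vtx -> Pi;
  simplices : {set {set vtx}};
  simplex_neq0 : set0 \notin simplices;
  simplex_face : forall s t : {set vtx},
    s \in simplices -> t \subset s -> t != set0 -> t \in simplices;
  simplex_chromatic : forall s : {set vtx},
    s \in simplices -> {in s &, injective color}
}.

Definition vertices (Pi : finType) (K : chromatic_complex Pi) : {set vtx K} :=
  cover (simplices K).

Definition star (Pi : finType) (K : chromatic_complex Pi) (v : vtx K) :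
    {set {set vtx K}} :=
  [set t in simplices K |
    [exists s in simplices K, (v \in s) && (t \subset s)]].

Definition chromatic_iso (Pi : finType) (K L : chromatic_complex Pi) : Prop :=
  exists f : {x : vtx K | x \in vertices K} -> {y : vtx L | y \in vertices L},
    [/\ bijective f,
        forall x, color (val (f x)) = color (val x)
      & forall s : {set {x : vtx K | x \in vertices K}},
          ([set val x | x in s] \in simplices K)
          = ([set val (f x) | x in s] \in simplices L)].

(* Algorithms of the family ITER, for input states in V.  Rounds are numbered
   0, ..., rounds - 1, and [st k] is the type of local states at the start of
   round k, so that [st rounds] is that of final states.  The process identifier
   is part of a local state; it is passed separately to [enc] and [next].
   [None] is the initial register content; an encoding function may also
   return it, and then the write leaves the register unchanged. *)
Record iter_alg (Pi V : finType) := IterAlg {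
  rounds : nat;
  st : nat -> finType;
  reg : nat -> Type;
  init : V -> st 0;
  enc : forall k, Pi -> st k -> option (reg k);
  next : forall k, Pi -> st k -> {ffun Pi -> option (reg k)} -> st k.+1
}.

(* Atomic steps: [wr k i] is the write of process i to M[k,i], [rd k i j] its
   read of M[k,j]. *)
Definition event (Pi : finType) : Type := (nat * Pi * option Pi)%type.
Definition wr (Pi : finType) (k : nat) (i : Pi) : event Pi := (k, i, None).
Definition rd (Pi : finType) (k : nat) (i j : Pi) : event Pi := (k, i, Some j).

Section Execution.
Variables (Pi : finType) (I : chromatic_complex Pi).
Variables (A : iter_alg Pi (vtx I)) (s : {set vtx I}).

(* Executions of A with the iterated collect pattern from the input
   configuration s: all interleavings of the steps of the participating
   processes.  A process crashes by taking no further step. *)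
Inductive ic_execution : seq (event Pi) -> Prop :=
| ic_start : ic_execution [::]
| ic_write h k i : ic_execution h ->
    i \in [set color v | v in s] -> k < rounds A -> wr k i \notin h ->
    (forall k' j, k' < k -> rd k' i j \in h) ->
    ic_execution (rcons h (wr k i))
| ic_read h k i j : ic_execution h ->
    wr k i \in h -> rd k i j \notin h ->
    ic_execution (rcons h (rd k i j)).

(* [local_state h k i] is the local state of i after its first k rounds, and
   [None] if i does not participate or does not complete these rounds in h.  As
   M[k,j] is written at most once, a read of it returns what j writes in round k
   if that write occurs earlier in h, and the initial content otherwise. *)
Fixpoint local_state (h : seq (event Pi)) (k : nat) (i : Pi) :
    option (st A k) :=
  match k with
  | 0 => omap (@init _ _ A) [pick v in s | color v == i]
  | k'.+1 =>
      if [forall j, rd k' i j \in h] then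
        omap (fun x => next i x
          [ffun j => if wr k' j \in take (index (rd k' i j) h) h
                     then obind (enc j) (local_state h k' j) else None])
          (local_state h k' i)
      else None
  end.

End Execution.

Section ProtocolComplex.
Variables (Pi : finType) (I : chromatic_complex Pi) (A : iter_alg Pi (vtx I)).

Definition protocol_simplices : {set {set Pi * st A (rounds A)}} :=
  [set t | (t != set0) && `[< exists (s : {set vtx I}) (h : seq (event Pi)),
     [/\ s \in simplices I, ic_execution A s h
       & forall p, p \in t -> local_state A s h (rounds A) p.1 = Some p.2] >]].

Fact protocol_neq0 : set0 \notin protocol_simplices.
Proof. by rewrite inE eqxx. Qed.

Fact protocol_face (s t : {set Pi * st A (rounds A)}) :
  s \in protocol_simplices -> t \subset s -> t != set0 ->
  t \in protocol_simplices.
Proof.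
rewrite !inE => /andP[_ /asboolP[s0 [h [s0I hh hs]]]] /subsetP ts ->/=.
by apply/asboolP; exists s0, h; split=> // p /ts /hs.
Qed.

Fact protocol_chromatic (s : {set Pi * st A (rounds A)}) :
  s \in protocol_simplices -> {in s &, injective fst}.
Proof.
rewrite inE => /andP[_ /asboolP[s0 [h [_ _ hs]]]] [i x] [j y] /hs /= hx /hs /=.
by move=> hy ij; move: hy; rewrite -ij hx => -[->].
Qed.

Definition protocol_complex : chromatic_complex Pi :=
  ChromaticComplex protocol_neq0 protocol_face protocol_chromatic.

End ProtocolComplex.

Fixpoint fi_st (Pi V : finType) (k : nat) : finType :=
  if k is k'.+1 then {ffun Pi -> option (fi_st Pi V k')} : finType else V.

Definition fi_ic (Pi V : finType) : iter_alg Pi V :=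
  @IterAlg Pi V 1 (fi_st Pi V) (fi_st Pi V) id
    (fun k _ x => Some x) (fun k _ _ view => view).

Section GreedyStar.
Variables (Pi : finType) (I : chromatic_complex Pi).

Definition encoding : Type := {ffun vtx I -> option nat}.

Definition gs_free (U : {set {set vtx I}}) (v : vtx I) : Prop :=
  forall w, w \in cover (star v) -> star w :&: U = set0.

(* [gs_for vs U Vu om U' Vu' om']: the for loop over the sequence vs can turn
   (U, Vu, om) into (U', Vu', om'). *)
Inductive gs_for : seq (vtx I) ->
    {set {set vtx I}} -> {set vtx I} -> encoding ->
    {set {set vtx I}} -> {set vtx I} -> encoding -> Prop :=
| gs_for_nil U Vu (om : encoding) : gs_for [::] U Vu om U Vu om
| gs_for_skip v vs U Vu (om : encoding) U' Vu' (om' : encoding) :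
    ~ gs_free U v ->
    gs_for vs U Vu om U' Vu' om' ->
    gs_for (v :: vs) U Vu om U' Vu' om'
| gs_for_add v vs U Vu (om om1 : encoding) U' Vu' (om' : encoding) :
    gs_free U v ->
    (forall u, u \notin cover (star v) -> om1 u = om u) ->
    (forall u, u \in cover (star v) -> om1 u <> None) ->
    (forall u w, u \in cover (star v) -> w \in cover (star v) ->
       color u = color w -> om1 u = om1 w -> u = w) ->
    gs_for vs (U :|: star v) (Vu :|: cover (star v)) om1 U' Vu' om' ->
    gs_for (v :: vs) U Vu om U' Vu' om'.

(* [gs_while Acc V W Wout]: the while loop entered with these values of the
   variables can terminate and return Wout.  The vertices of V may be visited
   in any order. *)
Inductive gs_while : {set {set vtx I}} -> {set vtx I} -> seq encoding ->
    seq encoding -> Prop :=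
| gs_while_end V W : gs_while (simplices I) V W W
| gs_while_iter Acc (V : {set vtx I}) W vs U Vu om Wout :
    Acc <> simplices I ->
    uniq vs -> vs =i V ->
    gs_for vs set0 set0 [ffun=> None] U Vu om ->
    gs_while (Acc :|: U) (V :\: Vu) (rcons W om) Wout ->
    gs_while Acc V W Wout.

Definition greedy_star (W : seq encoding) : Prop :=
  gs_while set0 (vertices I) [::] W.

Definition own_input (i : Pi) (x : {set vtx I}) : option (vtx I) :=
  [pick v in x | color v == i].

(* Different stars of one round may reuse the same values, so a process at v
   inverts the encoding among the vertices that can occur together with v. *)
Definition gs_decode (om : encoding) (v : vtx I)
    (view : {ffun Pi -> option nat}) : {set vtx I} :=
  [set u in cover (star v) | om u && (om u == view (color u))].

Definition gs_next (om : encoding) (i : Pi) (x : {set vtx I})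
    (view : {ffun Pi -> option nat}) : {set vtx I} :=
  if own_input i x is Some v then
    if om v is Some _ then x :|: gs_decode om v view else x
  else x.

Definition gs_alg (W : seq encoding) : iter_alg Pi (vtx I) :=
  let om k := nth [ffun=> None] W k in
  @IterAlg Pi (vtx I) (size W) (fun=> {set vtx I} : finType) (fun=> nat)
    set1
    (fun k i x => obind (om k) (own_input i x))
    (fun k i x view => gs_next (om k) i x view).

End GreedyStar.

(* Main.v *)
Require Import Defs.
From mathcomp Require Import all_boot.
From mathcomp Require Import boolp zify.

(* In both algorithms a process ends up with the set of the inputs it has seen,
   stored as a set or as an indexed view, so it suffices that the same families
   of sets arise jointly.  In one round of iterated collect on an input simplex
   s, these are the families for which "i misses j" is contained in a strict
   order, the order of the writes; a family of this kind is obtained by letting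
   everyone read those it misses right after its own write and the others at the
   end.  Repeating such a round gives every one-round outcome to GS.  Conversely,
   when the greedy loop stops, s is inside a star chosen in some round, where all
   of s writes; missing a process throughout GS means missing it in that round,
   and the writes of that round order the misses.  Decoding is correct since two
   stars chosen in one round have no adjacent vertices. *)

Set Implicit Arguments.
Unset Strict Implicit.
Unset Printing Implicit Defensive.

(** * Isomorphism from mutually inverse simplicial maps *)

Section IsoCriterion.
Variables (Pi : finType) (K L : chromatic_complex Pi).
Variables (f : vtx K -> vtx L) (g : vtx L -> vtx K).

(** Carriers may contain non-vertices, so the maps need only be inverse on vertices. Simplices are
    reflected because applying [g] to the image under [f] gives back the original set. *)
Lemma chromatic_iso_of_inverse :
  (forall x, color (f x) = color x) ->
  (forall t, t \in simplices K -> f @: t \in simplices L) ->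
  (forall t, t \in simplices L -> g @: t \in simplices K) ->
  {in vertices K, cancel f g} -> {in vertices L, cancel g f} ->
  chromatic_iso K L.
Proof.
move=> colf Hf Hg fK gK.
have Vf x : x \in vertices K -> f x \in vertices L.
  move=> /bigcupP[t tK xt]; apply/bigcupP; exists (f @: t); first exact: Hf.
  exact: imset_f.
have Vg y : y \in vertices L -> g y \in vertices K.
  move=> /bigcupP[t tL yt]; apply/bigcupP; exists (g @: t); first exact: Hg.
  exact: imset_f.
exists (fun x => exist _ (f (val x)) (Vf _ (valP x))); split=> [|x|s] //=.
  exists (fun y => exist _ (g (val y)) (Vg _ (valP y))) => x; apply: val_inj.
    exact: fK (valP x).
  exact: gK (valP x).
have -> : [set f (val x) | x in s] = f @: [set val x | x in s].
  by rewrite -imset_comp.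
apply/idP/idP => [/Hf //|/Hg]; rewrite -imset_comp.
suff -> : [set (g \o f) x | x in [set val x | x in s]] = [set val x | x in s] by [].
rewrite -[RHS]imset_id; apply: eq_in_imset => _ /imsetP[x _ ->] /=.
exact: fK (valP x).
Qed.

End IsoCriterion.

(** * Order of events in iterated collect executions *)

Section Execution.
Variables (Pi : finType) (I : chromatic_complex Pi).
Variables (A : iter_alg Pi (vtx I)) (s : {set vtx I}).

Local Notation participants := [set color v | v in s].

Definition before (h : seq (event Pi)) (e e' : event Pi) : bool :=
  e \in take (index e' h) h.

Definition completed (h : seq (event Pi)) (k : nat) (i : Pi) : bool :=
  [forall j, rd k i j \in h].

Lemma beforeE h e e' : before h e e' = (e \in h) && (index e h < index e' h).
Proof.
rewrite /before; case: (boolP (e \in h)) => [eh|neh] /=; first exact: in_take.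
by apply: contraNF neh => /mem_take.
Qed.

Lemma before_rcons h e e' x : e' \in h -> before (rcons h x) e e' = before h e e'.
Proof.
move=> e'h; rewrite /before -cats1 index_cat e'h takel_cat //.
exact: index_size.
Qed.

Lemma before_last h e x : x \notin h -> before (rcons h x) e x = (e \in h).
Proof.
by move=> xh; rewrite /before -cats1 index_cat (negbTE xh) /= eqxx addn0 take_size_cat.
Qed.

Lemma ic_executionP h : ic_execution A s h ->
  (forall k i, wr k i \in h ->
     [/\ i \in participants, k < rounds A & forall k', k' < k -> completed h k' i]) /\
  (forall k i j, rd k i j \in h -> before h (wr k i) (rd k i j)).
Proof.
elim=> [|{}h k i _ [IHw IHr] si kR wh hh|{}h k i j _ [IHw IHr] wh rh]; first by [].
- split=> [k' i'|k' i' j].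
    rewrite mem_rcons inE => /orP[/eqP[-> ->]|/IHw[-> -> H]]; split=> // k'' /=.
      by move=> kk; apply/forallP => j; rewrite mem_rcons inE hh ?orbT.
    by move=> /H/forallP H'; apply/forallP => j; rewrite mem_rcons inE H' ?orbT.
  rewrite mem_rcons inE => /orP[/eqP//|rh].
  by rewrite before_rcons // IHr.
- split=> [k' i'|k' i' j'].
    rewrite mem_rcons inE => /orP[/eqP//|/IHw[-> -> H]]; split=> // k'' /H/forallP H'.
    by apply/forallP => j'; rewrite mem_rcons inE H' ?orbT.
  rewrite mem_rcons inE => /orP[/eqP[-> -> ->]|rh'].
    by rewrite before_last.
  by rewrite before_rcons // IHr.
Qed.

(** The read by [i] follows the write of [i], and a missed write comes after that read or never. In
    the latter case its index is the size of [h], which still exceeds that of [wr k i]. *)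
Lemma ic_execution_missed h k i j : ic_execution A s h -> completed h k i ->
  ~~ before h (wr k j) (rd k i j) -> index (wr k i) h < index (wr k j) h.
Proof.
move=> /ic_executionP[_ Hr] /forallP/(_ j) ri; have := Hr _ _ _ ri.
rewrite !beforeE negb_and => /andP[wi lt1] /orP[/memNindex ->|].
  by rewrite index_mem.
by rewrite -leqNgt; apply: leq_trans.
Qed.

Lemma ic_execution_of_order h : uniq h ->
  (forall k i, wr k i \in h -> [/\ i \in participants, k < rounds A &
     forall k' j, k' < k -> before h (rd k' i j) (wr k i)]) ->
  (forall k i j, rd k i j \in h -> before h (wr k i) (rd k i j)) ->
  ic_execution A s h.
Proof.
elim/last_ind: h => [|h e IH]; first by move=> *; exact: ic_start.
rewrite rcons_uniq => /andP[eh uh] Hw Hr.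
have {}IH : ic_execution A s h.
  apply: IH => // [k i wh|k i j rh].
    have [|si kR H] := Hw k i; first by rewrite mem_rcons inE wh orbT.
    by split=> // k' j /(H _ j); rewrite before_rcons.
  by have := Hr k i j; rewrite before_rcons // mem_rcons inE rh orbT; apply.
case: e => [[k i] [j|]] in eh Hw Hr *.
  apply: ic_read => //; have := Hr k i j; rewrite before_last //; apply.
  by rewrite mem_rcons mem_head.
have [|si kR H] := Hw k i; first by rewrite mem_rcons mem_head.
apply: ic_write => // k' j /(H _ j).
by rewrite before_last.
Qed.

Lemma local_state_Some h k i x : local_state A s h k i = Some x ->
  i \in participants /\ forall k', k' < k -> completed h k' i.
Proof.
elim: k x => [|k IH] x /=.
  case: pickP => //= v /andP[vs /eqP <-] _; split=> //; exact: imset_f.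
case: ifP => // Hk; case E: (local_state A s h k i) => [y|] //= _.
have [si H] := IH _ E; split=> // k'; rewrite ltnS leq_eqVlt => /orP[/eqP ->|/H //].
exact: Hk.
Qed.

End Execution.

(* [see i j]: i reads j after the write of j; [rk]: time of the write. *)
Definition schedule (Pi : finType) (I : chromatic_complex Pi) (s : {set vtx I})
    (see : rel Pi) (rk : Pi -> nat) : Prop :=
  {in [set color v | v in s] &, forall i j, ~~ see i j -> rk i < rk j}.

(** * Realizing a schedule by an execution *)

Section Realization.
Variables (Pi : finType) (I : chromatic_complex Pi).
Variables (A : iter_alg Pi (vtx I)) (s : {set vtx I}).
Variables (see : rel Pi) (rk : Pi -> nat).
Hypothesis sched : schedule s see rk.

Local Notation participants := [set color v | v in s].

Let M := (\max_i rk i).+1.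

Let rkM i : rk i < M. Proof. exact: leq_bigmax. Qed.

(* In every round, a process reads those it misses right after its own write,
   and the others after all the writes of the round. *)
Let time (e : event Pi) : nat :=
  let: (k, i, o) := e in
  k * (2 * M + 1) +
    (if o is Some j then if see i j then 2 * M else (2 * rk i).+1 else 2 * rk i).

Let events : seq (event Pi) :=
  [seq (nat_of_ord x.1.1, x.1.2, x.2) |
    x : 'I_(rounds A) * Pi * option Pi <- enum predT & x.1.2 \in participants].

(** The events are sorted by [time]. A round occupies [2 * M + 1] units: writes have even offsets
    below [2 * M], early reads the odd offset just after the own write, late reads the offset
    [2 * M]. If [i] misses [j], then [rk i < rk j] puts the early read before the write of [j]. *)
Lemma realize_schedule : exists h,
  [/\ ic_execution A s h,
      forall k i, k < rounds A -> i \in participants -> completed h k i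
    & forall k i j, k < rounds A -> i \in participants ->
        before h (wr k j) (rd k i j) = (j \in participants) && see i j].
Proof.
pose h := sort (fun e e' => time e <= time e') events.
have hE k i o : ((k, i, o) \in h) = (k < rounds A) && (i \in participants).
  rewrite mem_sort; apply/mapP/andP => [[[[k' i'] o']]|[kR si]].
    by rewrite mem_filter /= => /andP[si _] [-> -> _].
  by exists (Ordinal kR, i, o); rewrite // mem_filter mem_enum andbT.
have uh : uniq h.
  rewrite sort_uniq map_inj_uniq; first exact/filter_uniq/enum_uniq.
  by move=> [[k i] o] [[k' i'] o'] /= [/val_inj -> -> ->].
have timeP e e' : e \in h -> e' \in h -> time e < time e' -> before h e e'.
  move=> eh e'h; rewrite beforeE eh /= !ltnNge; apply: contra => le.
  have srt : sorted (fun e e' => time e <= time e') h.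
    by apply: sort_sorted => x y; exact: leq_total.
  have tr : transitive (fun e e' => time e <= time e').
    by move=> y x z; exact: leq_trans.
  by apply: (sorted_leq_index tr _ srt) => // x; exact: leqnn.
exists h; split=> [|k i kR si|k i j kR si].
- apply: ic_execution_of_order => // [k i|k i j]; rewrite hE => /andP[kR si].
    split=> // k' j kk; apply: timeP; rewrite ?hE ?si ?kR ?(ltn_trans kk) //=.
    by have := rkM i; case: (see i j) => /=; nia.
  apply: timeP; rewrite ?hE ?si ?kR //=.
  by have := rkM i; case: (see i j) => /=; lia.
- by apply/forallP => j; rewrite hE kR si.
case: (boolP (j \in participants)) => sj /=; last first.
  by rewrite beforeE hE (negbTE sj) andbF.
case: (boolP (see i j)) => sij.
  apply: timeP; rewrite ?hE ?si ?sj ?kR //= sij.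
  by have := rkM j; lia.
have : before h (rd k i j) (wr k j).
  apply: timeP; rewrite ?hE ?si ?sj ?kR //= (negbTE sij).
  by have := sched si sj sij; lia.
by rewrite !beforeE !hE si sj kR /= => lt; apply/negbTE; rewrite -leqNgt ltnW.
Qed.

End Realization.

(** A common description of both protocol complexes: only the encoding [view] of what is seen
    differs. *)
Definition realizable (Pi : finType) (I : chromatic_complex Pi) (T : finType)
    (view : {set vtx I} -> rel Pi -> Pi -> T) (t : {set Pi * T}) : Prop :=
  exists s see rk, [/\ s \in simplices I, schedule s see rk &
    forall p, p \in t -> p.1 \in [set color v | v in s] /\ p.2 = view s see p.1].

Section Input.
Variables (Pi : finType) (I : chromatic_complex Pi).
Variables (s : {set vtx I}) (sI : s \in simplices I).

Lemma own_inputE v : v \in s -> own_input (color v) s = Some v.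
Proof.
move=> vs; rewrite /own_input; case: pickP => [w /andP[ws /eqP wv]|/(_ v)].
  by rewrite (simplex_chromatic sI ws vs wv).
by rewrite vs eqxx.
Qed.

Lemma own_input_Some i v : own_input i s = Some v -> v \in s /\ color v = i.
Proof. by rewrite /own_input; case: pickP => // w /andP[ws /eqP wi] [<-]. Qed.

Lemma own_input_None i : i \notin [set color v | v in s] -> own_input i s = None.
Proof.
move=> si; case E: (own_input i s) => [v|] //.
have [vs vi] := own_input_Some E.
by case/negP: si; apply/imsetP; exists v.
Qed.

End Input.

(** * One round of full information *)

Section FullInformation.
Variables (Pi : finType) (I : chromatic_complex Pi).

Definition fi_view (s : {set vtx I}) (see : rel Pi) (i : Pi) :
    {ffun Pi -> option (vtx I)} :=
  [ffun j => if see i j then own_input j s else None].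

Lemma local_state_fi (s : {set vtx I}) (h : seq (event Pi)) i :
  i \in [set color v | v in s] -> completed h 0 i ->
  local_state (fi_ic Pi (vtx I)) s h 1 i
  = Some (fi_view s (fun i j => before h (wr 0 j) (rd 0 i j)) i).
Proof.
move=> /imsetP[v vs ->]; rewrite /completed /= => ->; case: pickP => [w _ /=|/(_ v)].
  congr Some; apply/ffunP => j; rewrite !ffunE /before; case: ifP => // _.
  by rewrite /own_input; case: pickP.
by rewrite vs eqxx.
Qed.

Lemma fi_simplexP (t : {set Pi * {ffun Pi -> option (vtx I)}}) :
  reflect (t != set0 /\ realizable fi_view t)
          (t \in simplices (protocol_complex (fi_ic Pi (vtx I)))).
Proof.
rewrite inE; apply: (iffP andP) => [[-> /asboolP[s [h [sI ih ht]]]]|[-> H]]; split=> //.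
  (* A process with unfinished reads is declared to see everyone, so that it puts no constraint on
     the order of the writes; it has no final state in [t]. *)
  pose see i j := completed h 0 i ==> before h (wr 0 j) (rd 0 i j).
  exists s, see, (fun i => index (wr 0 i) h).
  split=> // [i j _ _|p /ht lp].
    by rewrite negb_imply => /andP[ci]; exact: ic_execution_missed ih ci.
  have [si /(_ 0 isT) ci] := local_state_Some lp; split=> //.
  have := local_state_fi si ci; rewrite lp => -[->]; apply/ffunP => j.
  by rewrite !ffunE /see ci.
apply/asboolP; case: H => s [see [rk [sI sc ht]]].
have [h [ih ch bh]] := realize_schedule (fi_ic Pi (vtx I)) sc.
exists s, h; split=> // p /ht[si ->]; rewrite local_state_fi ?ch //.
congr Some; apply/ffunP => j; rewrite !ffunE bh //.
by case: (boolP (j \in _)) => //= sj; rewrite own_input_None // if_same.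
Qed.

End FullInformation.

(** * Greedy Star encodings and the protocol complex of GS *)

Section GreedyStar.
Variables (Pi : finType) (I : chromatic_complex Pi).
Implicit Types (U : {set {set vtx I}}) (om : encoding I) (u v w c : vtx I).

Definition locally_decodable om : Prop :=
  forall v u w, om v -> om u -> om w -> u \in cover (star v) -> w \in cover (star v) ->
    color u = color w -> om u = om w -> u = w.

Lemma in_cover_star u v :
  reflect (exists2 t, t \in simplices I & (u \in t) && (v \in t)) (u \in cover (star v)).
Proof.
apply: (iffP bigcupP) => [[t]|[t tI /andP[ut vt]]].
  rewrite inE => /andP[tI /existsP[t' /and3P[t'I vt' /subsetP sub]]] ut.
  by exists t'; rewrite // vt' sub.
by exists t => //; rewrite inE tI; apply/existsP; exists t; rewrite tI vt subxx.
Qed.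

Lemma cover_starC u v : (u \in cover (star v)) = (v \in cover (star u)).
Proof.
by apply/in_cover_star/in_cover_star => -[t tI]; rewrite andbC; exists t.
Qed.

(** [inv_point] turns disjointness of families of simplices, as tested by [gs_free], into
    disjointness of their vertex sets. *)
Record gs_inv U om : Prop := GSInv {
  inv_point : forall x, x \in cover U -> [set x] \in U;
  inv_dom : forall x, om x = (x \in cover U) :> bool;
  inv_dec : locally_decodable om
}.

Lemma set1_star t c x : t \in star c -> x \in t -> [set x] \in star c.
Proof.
rewrite !inE => /andP[tI /existsP[t' /and3P[t'I ct' sub]]] xt; apply/andP; split.
  by apply: simplex_face tI _ _; rewrite ?sub1set // -cards_eq0 cards1.
by apply/existsP; exists t'; rewrite t'I ct' sub1set (subsetP sub).
Qed.

(** No vertex of the new star is adjacent to a vertex of [U]. Hence the writing neighbors of a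
    writing vertex lie all in the new star, where [om1] separates equal colors, or all in [U], where
    [om1] agrees with [om]. *)
Lemma gs_inv_add U om om1 c : gs_inv U om -> gs_free U c ->
  (forall u, u \notin cover (star c) -> om1 u = om u) ->
  (forall u, u \in cover (star c) -> om1 u <> None) ->
  (forall u w, u \in cover (star c) -> w \in cover (star c) ->
     color u = color w -> om1 u = om1 w -> u = w) ->
  gs_inv (U :|: star c) om1.
Proof.
move=> [Up Ud Uc] free out act inj.
(* Otherwise the simplex [[set x]] would lie in both [star u] and [U]. *)
have sep u x : u \in cover (star c) -> x \in cover U -> x \notin cover (star u).
  move=> uc /Up xU; apply/negP => /bigcupP[t tu xt].
  by have /setP/(_ [set x]) := free u uc; rewrite in_setI xU (set1_star tu xt) inE.
have coverU x : (x \in cover (U :|: star c)) = (x \in cover U) || (x \in cover (star c)).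
  by rewrite /cover bigcup_setU inE.
have dom x : om1 x = (x \in cover (U :|: star c)) :> bool.
  rewrite coverU; case: (boolP (x \in cover (star c))) => xc.
    by rewrite orbT; move: (act _ xc); case: (om1 x).
  by rewrite orbF out.
split=> //.
- move=> x; rewrite coverU inE => /orP[/Up -> //|/bigcupP[t tc xt]].
  by rewrite (set1_star tc xt) orbT.
move=> v u w; rewrite !dom !coverU.
case: (boolP (v \in cover (star c))) => vc.
  move=> _ uA wA uv wv; apply: inj.
    by case/orP: uA => // /(sep _ _ vc); rewrite uv.
  by case/orP: wA => // /(sep _ _ vc); rewrite wv.
rewrite orbF => vU.
have far u' : u' \in cover (star v) -> u' \notin cover (star c).
  by rewrite cover_starC => vu'; apply/negP => /sep/(_ vU); rewrite vu'.
move=> uA wA uv wv; rewrite !out ?far // => ecol eom.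
apply: (Uc v) => //; rewrite Ud //.
  by move: uA; rewrite (negbTE (far _ uv)) orbF.
by move: wA; rewrite (negbTE (far _ wv)) orbF.
Qed.

Lemma gs_for_inv vs U Vu om U' Vu' om' :
  gs_for vs U Vu om U' Vu' om' -> gs_inv U om -> gs_inv U' om'.
Proof.
elim=> // {}vs0 {}vs1 U0 Vu0 om0 om1 U1 Vu1 om2 free out act inj _ IH inv.
exact: IH (gs_inv_add inv free out act inj).
Qed.

Definition active_on om (s : {set vtx I}) : Prop := forall v, v \in s -> om v.

(** A simplex enters [Acc] in a round that makes all its vertices write; the loop ends with [Acc]
    equal to [simplices I]. *)
Lemma gs_while_inv Acc (V : {set vtx I}) (W Wout : seq (encoding I)) :
  gs_while Acc V W Wout ->
  (forall om, om \in W -> locally_decodable om) ->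
  (forall s, s \in Acc -> exists2 om, om \in W & active_on om s) ->
  (forall om, om \in Wout -> locally_decodable om) /\
  (forall s, s \in simplices I -> exists2 om, om \in Wout & active_on om s).
Proof.
elim=> // {}Acc {}V {}W vs U Vu om {}Wout _ _ _ Hfor _ IH HW HA.
have [|_ Ud Uc] := gs_for_inv Hfor.
  split=> [x|x|v]; rewrite ?ffunE //.
    by rewrite /cover big_set0 inE.
  by rewrite /cover big_set0 inE.
apply: IH => [om'|s]; first by rewrite mem_rcons inE => /orP[/eqP ->|/HW].
rewrite inE => /orP[/HA[om' omW act]|sU].
  by exists om' => //; rewrite mem_rcons inE omW orbT.
exists om; first by rewrite mem_rcons mem_head.
by move=> v vs'; rewrite Ud; apply/bigcupP; exists s.
Qed.

Lemma greedy_starP (W : seq (encoding I)) : greedy_star W ->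
  (forall om, om \in W -> locally_decodable om) /\
  (forall s, s \in simplices I -> exists2 om, om \in W & active_on om s).
Proof. by move=> /gs_while_inv; apply=> // s; rewrite inE. Qed.

Definition gs_view (s : {set vtx I}) (see : rel Pi) (i : Pi) : {set vtx I} :=
  [set v in s | see i (color v)].

Variables (W : seq (encoding I)) (HW : greedy_star W).

Definition talks (s : {set vtx I}) (k : nat) (i : Pi) : bool :=
  obind (nth [ffun=> None] W k) (own_input i s).

(** Knowledge is never relayed: a process writes only the code of its own input, so inputs are
    learned by direct reads alone. *)
Definition learns (s : {set vtx I}) (h : seq (event Pi)) (k : nat) : rel Pi :=
  fun i j => (i == j) ||
    has (fun k' => [&& talks s k' i, talks s k' j & before h (wr k' j) (rd k' i j)])
        (iota 0 k).

Lemma learnsS s h k i j : learns s h k.+1 i j = learns s h k i j ||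
  [&& talks s k i, talks s k j & before h (wr k j) (rd k i j)].
Proof. by rewrite /learns -addn1 iotaD has_cat /= orbF orbA. Qed.

Lemma talksE s k v : s \in simplices I -> v \in s ->
  talks s k (color v) = nth [ffun=> None] W k v.
Proof. by move=> sI vs; rewrite /talks own_inputE. Qed.

Lemma own_input_view (s : {set vtx I}) (see : rel Pi) i : s \in simplices I -> see i i ->
  own_input i (gs_view s see i) = own_input i s.
Proof.
move=> sI sii; apply: eq_pick => v; rewrite inE.
by case: eqP => [->|]; rewrite ?sii ?andbT ?andbF.
Qed.

Lemma local_state_gs (s : {set vtx I}) (h : seq (event Pi)) k i :
  s \in simplices I -> k <= size W ->
  ic_execution (gs_alg W) s h ->
  i \in [set color v | v in s] -> (forall k', k' < k -> completed h k' i) ->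
  local_state (gs_alg W) s h k i = Some (gs_view s (learns s h k) i).
Proof.
move=> sI kW ih; have [Hw _] := ic_executionP ih.
elim: k i kW => [|k IH] i kW /imsetP[v vs ->] ci.
  rewrite /=; case: pickP => [w /andP[ws /eqP wv]|/(_ v)]; last by rewrite vs eqxx.
  rewrite (simplex_chromatic sI ws vs wv) /=; congr Some; apply/setP => u.
  rewrite !inE /learns /= orbF.
  apply/eqP/andP => [->|[us /eqP uv]]; first by rewrite vs.
  exact: (simplex_chromatic sI).
have ck := ci k (leqnn _); rewrite /completed in ck; rewrite /= ck.
have refl k' i' : learns s h k' i' i' by rewrite /learns eqxx.
rewrite IH ?(ltnW kW) ?imset_f //; last by move=> k' kk; apply: ci; exact: ltnW.
rewrite /=; congr Some; rewrite /gs_next own_input_view // own_inputE //.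
set om := nth _ W k; set view := finfun _.
have viewE j : view j =
    if before h (wr k j) (rd k (color v) j) then obind om (own_input j s) else None.
  rewrite ffunE -/(before _ _ _); case: ifP => // b.
  have [sj _ cj] : [/\ j \in [set color v | v in s], k < size W &
      forall k', k' < k -> completed h k' j].
    by apply: Hw; exact: mem_take b.
  by rewrite IH ?(ltnW kW) //= own_input_view.
case Ev: (om v) => [n|]; last first.
  apply/setP => u; rewrite !inE; case: (boolP (u \in s)) => //= us.
  by rewrite learnsS talksE // -/om Ev /= orbF.
apply/setP => u; rewrite inE [in RHS]inE [X in X || _]inE learnsS.
case: (boolP (u \in s)) => [us|us] /=.
  rewrite !talksE // -/om Ev /=; congr (_ || _); rewrite inE viewE own_inputE //=.
  have -> /= : u \in cover (star v) by apply/in_cover_star; exists s; rewrite ?us.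
  by case: (om u) => [m|] //=; case: ifP => //= _; rewrite eqxx.
(* A vertex [u] outside [s] is never decoded: the value read was written at some [w] in [s] of the
   same color, and both are adjacent to [v], so local decodability would force [u = w]. *)
apply/negP; rewrite inE viewE => /and3P[uv omu /eqP]; case: ifP => [_|_ eu]; last first.
  by rewrite eu in omu.
case E: (own_input _ s) => [w|] /= eu; last by rewrite eu in omu.
have [ws cw] := own_input_Some E; case/negP: us.
have omW : om \in W by apply: mem_nth.
rewrite (proj1 (greedy_starP HW) om omW v u w) ?Ev -?eu ?cw //.
by apply/in_cover_star; exists s; rewrite ?ws.
Qed.

Lemma gs_simplexP (t : {set Pi * {set vtx I}}) :
  reflect (t != set0 /\ realizable gs_view t)
          (t \in simplices (protocol_complex (gs_alg W))).
Proof.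
rewrite inE; apply: (iffP andP) => [[-> /asboolP[s [h [sI ih ht]]]]|[-> H]]; split=> //.
  (* All of [s] talks in round [k0], so a process that misses another one in
     every round misses it in this one: the writes of [k0] order the misses. *)
  have [om /(nthP [ffun=> None])[k0 k0W omE] act] := proj2 (greedy_starP HW) s sI.
  pose see i j := [forall k : 'I_(size W), completed h k i] ==> learns s h (size W) i j.
  exists s, see, (fun i => index (wr k0 i) h).
  split=> // [_ _ /imsetP[u us ->] /imsetP[v vs ->]|p /ht lp].
    rewrite negb_imply => /andP[/forallP/(_ (Ordinal k0W)) ci].
    rewrite negb_or => /andP[_ /hasPn/(_ k0)]; rewrite mem_iota /= add0n k0W => /(_ isT).
    by rewrite !talksE // omE !act //=; exact: ic_execution_missed ih ci.
  have [si ci] := local_state_Some lp; split=> //.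
  have := local_state_gs sI (leqnn _) ih si ci; rewrite lp => -[->]; apply/setP => v.
  rewrite !inE /see; suff -> : [forall k : 'I_(size W), completed h k p.1] by [].
  by apply/forallP => k; exact: ci.
apply/asboolP; case: H => s [see [rk [sI sc ht]]].
(* The same schedule is repeated in every round. Rounds with silent processes add nothing outside
   [see], and the round [k0], where all of [s] talks, supplies every seen input. *)
have [h [ih ch bh]] := realize_schedule (gs_alg W) sc.
have [om /(nthP [ffun=> None])[k0 k0W omE] act] := proj2 (greedy_starP HW) s sI.
exists s, h; split=> // p /ht[si ->].
rewrite local_state_gs //; last by move=> k kW; exact: ch.
congr Some; apply/setP => v; rewrite !inE; case: (boolP (v \in s)) => //= vs.
have sv : color v \in [set color v | v in s] by exact: imset_f.
apply/orP/idP => [[/eqP <-|/hasP[k]]|spv].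
(* A participant sees itself, since missing itself would give [rk i < rk i]. *)
- by apply: contraT => /(sc _ _ si si); rewrite ltnn.
- by rewrite mem_iota => /andP[_ kW] /and3P[_ _]; rewrite bh // sv.
right; apply/hasP; exists k0; first by rewrite mem_iota.
rewrite bh // sv spv; case/imsetP: si => u us ->.
by rewrite !talksE // omE !act.
Qed.

End GreedyStar.

(** * Translation between sets of inputs and indexed views *)

Section Correspondence.
Variables (Pi : finType) (I : chromatic_complex Pi).

Definition view_of_set (X : {set vtx I}) : {ffun Pi -> option (vtx I)} :=
  [ffun j => own_input j X].

Definition set_of_view (x : {ffun Pi -> option (vtx I)}) : {set vtx I} :=
  [set v | x (color v) == Some v].

(** Whether a vertex is seen depends only on its color, so filtering by [see] commutes with picking
    the vertex of color [j]. *)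
Lemma view_of_gs_view (s : {set vtx I}) (see : rel Pi) i : s \in simplices I ->
  view_of_set (gs_view s see i) = fi_view s see i.
Proof.
move=> sI; apply/ffunP => j; rewrite !ffunE /own_input; case: ifP => sij.
  by apply: eq_pick => v; rewrite inE; case: eqP => [->|]; rewrite ?sij ?andbT ?andbF.
by case: pickP => // v /andP[]; rewrite inE => /andP[_ sv] /eqP vj; rewrite -vj sv in sij.
Qed.

Lemma set_of_fi_view (s : {set vtx I}) (see : rel Pi) i : s \in simplices I ->
  set_of_view (fi_view s see i) = gs_view s see i.
Proof.
move=> sI; apply/setP => v; rewrite !inE ffunE.
case: ifP => sv; rewrite ?andbF // andbT.
by apply/eqP/idP => [/own_input_Some[]|/(own_inputE sI)].
Qed.

(** The same [s], [see] and [rk] serve as witnesses for the translated family. *)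
Lemma realizable_imset (T T' : finType) (f : T -> T')
    (view : {set vtx I} -> rel Pi -> Pi -> T)
    (view' : {set vtx I} -> rel Pi -> Pi -> T') (t : {set Pi * T}) :
  (forall s see i, s \in simplices I -> f (view s see i) = view' s see i) ->
  realizable view t -> realizable view' [set (p.1, f p.2) | p in t].
Proof.
move=> fE [s [see [rk [sI sc ht]]]]; exists s, see, rk; split=> //.
by move=> _ /imsetP[p /ht[si ->] ->] /=; rewrite fE.
Qed.

End Correspondence.

Theorem theorem3 (Pi : finType) (I : chromatic_complex Pi)
    (W : seq (encoding I)) (HW : greedy_star W) :
  chromatic_iso (protocol_complex (gs_alg W)) (protocol_complex (fi_ic Pi (vtx I))).
Proof.
apply: (@chromatic_iso_of_inverse _ (protocol_complex (gs_alg W))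
  (protocol_complex (fi_ic Pi (vtx I)))
  (fun p => (p.1, view_of_set p.2)) (fun p => (p.1, set_of_view p.2))) => //.
- move=> t /(gs_simplexP HW)[t0 rt]; apply/fi_simplexP; split.
    by rewrite imset_eq0.
  by apply: realizable_imset rt => s see i; exact: view_of_gs_view.
- move=> t /fi_simplexP[t0 rt]; apply/(gs_simplexP HW); split.
    by rewrite imset_eq0.
  by apply: realizable_imset rt => s see i; exact: set_of_fi_view.
(* The translations are inverse on vertices because there the states are views of an input simplex;
   an arbitrary set could contain two vertices of one color. *)
- move=> [i X] /bigcupP[t /(gs_simplexP HW)[_ [s [see [rk [sI _ ht]]]]] /ht[_ /= ->]].
  by rewrite view_of_gs_view // set_of_fi_view.
- move=> [i X] /bigcupP[t /fi_simplexP[_ [s [see [rk [sI _ ht]]]]] /ht[_ /= ->]].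
  by rewrite set_of_fi_view // view_of_gs_view.
Qed.
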